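(* There is an absolute constant $m_0$ such that the following holds for every integer $m\ge m_0$. Let $N_1,N_2$ be positive integers, $I_1=[1,N_1]$, $I_2=[1,N_2]$, and let $\alpha_1(x_1),\alpha_2(x_2)\in\mathbb{C}$ be arbitrary coefficients with $|\alpha_i(x_i)|\le 1$ for all integers $x_i\in I_i$, $i=1,2$. Then for all positive integers $k_1,k_2$ and all integers $a$ with $\gcd(a,m)=1$ we have $$\Bigl|\sum_{x_1\in I_1}\sum_{x_2\in I_2}\alpha_1(x_1)\alpha_2(x_2)e_m(ax_1^*x_2^* )\Bigr| < (2k_1)^{\frac{45k_1^2}{k_2}}(2k_2)^{\frac{45k_2^2}{k_1}}(\log m)^{2\left(\frac{k_1}{k_2}+\frac{k_2}{k_1}\right)}\Bigl(\frac{N_1^{k_1-1}}{m^{1/2}}+\frac{m^{1/2}}{N_1^{k_1}}\Bigr)^{1/(2k_1k_2)}\Bigl(\frac{N_2^{k_2-1}}{m^{1/2}}+\frac{m^{1/2}}{N_2^{k_2}}\Bigr)^{1/(2k_1k_2)}N_1N_2.$$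
   Context: $e_m(z)=e^{2\pi i z/m}$. For an integer $x$ coprime to $m$, $x^*$ denotes the multiplicative inverse of $x$ modulo $m$. Sums involving $x^*$ are restricted to integers $x$ coprime to $m$; thus $x_1$ and $x_2$ run over the integers in $I_1$, $I_2$ respectively that are coprime to $m$. *)

(* Defs.v *)
From mathcomp Require Import all_boot all_order all_algebra.
From mathcomp Require Import complex.
From mathcomp Require Import reals exp trigo.

Set Implicit Arguments.
Unset Strict Implicit.
Unset Printing Implicit Defensive.

Import Order.TTheory GRing.Theory Num.Theory.

Local Open Scope ring_scope.
Local Open Scope complex_scope.

(* e_m(z) = exp(2 pi i z / m), written out by Euler's formula. *)
Definition e_ (R : realType) (m : nat) (z : R) : R[i] :=
  let t := 2 * pi * z / m%:R in cos t +i* sin t.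

(* The representative in [0, m) of the inverse of x modulo m, for x coprime
   to m > 1 (see [modinvP]).  For m <= 1 the type 'Z_m is the ring Z/2, so the
   definition is meaningful for m > 1 only. *)
Definition modinv (m x : nat) : nat := (x%:R^-1 : 'Z_m).

Lemma modinv_lt (m x : nat) : (1 < m)%N -> (modinv m x < m)%N.
Proof. by move=> m1; rewrite -[X in (_ < X)%N](Zp_cast m1) ltn_ord. Qed.

Lemma modinvP (m x : nat) : (1 < m)%N -> coprime x m ->
  (x * modinv m x = 1 %[mod m])%N.
Proof.
case: m => [|[|m]] // _ cxm.
have ux : (x%:R : 'Z_m.+2) \is a GRing.unit by rewrite unitZpE // coprime_sym.
have /(congr1 val) := mulrV ux.
by rewrite /= val_Zp_nat // modnMml => ->; rewrite modn_small.
Qed.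

(* Main.v *)
(* Write S for the sum and J_i for the number of pairs of k_i-tuples in [1, N_i]
   with the same sum of inverses modulo m.  Two applications of Holder's
   inequality, Cauchy-Schwarz and the orthogonality of the additive characters
   modulo m give
     |S| ^ (2 k1 k2) <= N1 ^ (2 k1 (k2 - 1)) N2 ^ (2 k2 (k1 - 1)) m J_1 J_2.
   To bound J, group the k-tuples by the rational number r = sum 1 / x_j = A / B,
   where A <= k N ^ (k - 1) and B <= N ^ k.  Two different fractions whose values
   agree modulo m satisfy |A B' - A' B| >= m, so a residue class contains at most
   2 (k N ^ (2 k - 1) / m + 1) values of r, and by Cauchy-Schwarz J is at most that
   number times the number of solutions of
     1 / x_1 + ... + 1 / x_k = 1 / x_(k+1) + ... + 1 / x_(2k)
   in rationals.  In a solution no prime divides the product x_1 ... x_(2k) exactly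
   once, so the x_i factor simultaneously into pair and triple factors; counting
   these factors bounds the number of solutions by
   N ^ k (1 + log N) ^ (4 k ^ 2) 3 ^ (8 k ^ 3). *)
Require Import Defs.
From mathcomp Require Import all_boot all_order all_algebra.
From mathcomp Require Import complex.
From mathcomp Require Import reals exp trigo.
From mathcomp Require Import zify ring lra.

Import Order.TTheory GRing.Theory Num.Theory.
Import Normc.

(** * Tuples without a lone prime *)

Section Decomposition.
Variable I : finType.

(** Indices may repeat and the exponents count occurrences, so [d (i, i)] enters coordinate [i]
    squared. Over all coordinates each [d q] has total exponent two and each [t q] three. *)
Definition pair_triple_product (d : I * I -> nat) (t : I * I * I -> nat) (i : I) : nat :=
  (\prod_q d q ^ ((q.1 == i) + (q.2 == i)) *
   \prod_q t q ^ ((q.1.1 == i) + (q.1.2 == i) + (q.2 == i)))%N.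

(** One removal of [p]; with the exponent written as [i0 == i], successive removals combine by
    adding exponents. *)
Lemma logn_sum_factor (p : nat) (x : I -> nat) :
  (forall i, 0 < x i)%N -> prime p -> (0 < \sum_i logn p (x i))%N ->
  exists (i0 : I) (x' : I -> nat),
    [/\ forall i, (0 < x' i)%N, forall i, x i = (x' i * p ^ (i0 == i))%N,
        \sum_i logn p (x i) = (\sum_i logn p (x' i)).+1 &
        forall q, prime q -> q != p -> \sum_i logn q (x i) = \sum_i logn q (x' i)].
Proof.
move=> x_gt0 p_pr; rewrite lt0n sum_nat_eq0 => /forallPn[i0] /=.
rewrite -lt0n logn_gt0 mem_primes p_pr x_gt0 /= => p_dvd.
pose x' i := if i0 == i then (x i %/ p)%N else x i.
have xE i : x i = (x' i * p ^ (i0 == i))%N.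
  by rewrite /x'; case: eqVneq => [<-|_]; rewrite ?divnK // muln1.
have x'_gt0 i : (0 < x' i)%N by move: (x_gt0 i); rewrite xE muln_gt0 => /andP[].
exists i0, x'; split => //.
  rewrite (bigD1 i0) // [in RHS](bigD1 i0) //= -addSn; congr (_ + _)%N.
    by rewrite xE eqxx lognM ?x'_gt0 ?expn_gt0 ?prime_gt0 // expn1 (logn_prime p p_pr) eqxx addn1.
  by apply: eq_bigr => i /negPf ne; rewrite xE eq_sym ne muln1.
move=> q q_pr neq; apply: eq_bigr => i _; rewrite xE lognM ?x'_gt0 ?expn_gt0 ?prime_gt0 //.
by rewrite lognX [logn q p]logn_prime // (negPf neq) muln0 addn0.
Qed.

Lemma prod_mul_at (K : finType) (d : K -> nat) (e : K -> nat) (q0 : K) (p : nat) :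
  (\prod_q (d q * p ^ (q0 == q)) ^ e q = (\prod_q d q ^ e q) * p ^ e q0)%N.
Proof.
under eq_bigr do rewrite expnMn; rewrite big_split /=; congr (_ * _)%N.
rewrite (bigD1 q0) //= big1 ?eqxx ?muln1 ?expn1 //.
by move=> i /negPf ne; rewrite eq_sym ne exp1n.
Qed.

(* An exponent total other than [1] is a sum of twos and threes, so each prime can
   be removed from two or three (not necessarily distinct) coordinates at a time. *)
Lemma pair_triple_decomposition (x : I -> nat) :
  (forall i, 0 < x i)%N -> (forall p, prime p -> \sum_i logn p (x i) != 1)%N ->
  exists d t, forall i, x i = pair_triple_product d t i.
Proof.
(* Induction on the product of the coordinates, which drops whenever a prime is removed. *)
have [n] := ubnP (\prod_i x i)%N; elim: n x => // n IHn x lt_x x_gt0 x_good.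
have [/forallP x1|/forallPn[j0 xj0]] := boolP [forall i, x i == 1%N].
  exists (fun=> 1%N), (fun=> 1%N) => i; rewrite (eqP (x1 i)) /pair_triple_product.
  by rewrite !big1 // => q _; rewrite exp1n.
have [p p_pr p_dvd] : exists2 p, prime p & (p %| x j0)%N.
  exists (pdiv (x j0)); rewrite ?pdiv_dvd // pdiv_prime //.
  by move: (x_gt0 j0) xj0; case: (x j0) => [|[]].
have s_gt0 : (0 < \sum_i logn p (x i))%N.
  by rewrite (bigD1 j0) // ltn_addr // logn_gt0 mem_primes p_pr x_gt0.
have smaller (y : I -> nat) (e : I -> nat) j : (forall i, 0 < y i)%N ->
    (forall i, x i = y i * p ^ e i)%N -> (0 < e j)%N -> (\prod_i y i < n)%N.
  move=> y_gt0 xE ej; apply: leq_trans (lt_x : _ <= n)%N.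
  rewrite [X in (_ < X)%N](eq_bigr _ (fun i _ => xE i)) big_split /= ltn_Pmulr //.
    rewrite (bigD1 j) //=; apply: (@leq_trans (p ^ 1 * 1)%N).
      by rewrite muln1 expn1 prime_gt1.
    rewrite leq_mul ?leq_pexp2l ?(prime_gt0 p_pr) //.
    by rewrite prodn_cond_gt0 // => i _; rewrite expn_gt0 prime_gt0.
  by rewrite prodn_gt0.
have [i1 [x1 [x1_gt0 xE1 s1 o1]]] := logn_sum_factor _ _ x_gt0 p_pr s_gt0.
have s1_gt0 : (0 < \sum_i logn p (x1 i))%N by have := x_good p p_pr; lia.
have [i2 [x2 [x2_gt0 xE2 s2 o2]]] := logn_sum_factor _ _ x1_gt0 p_pr s1_gt0.
have xE i : (x i = x2 i * p ^ ((i1 == i) + (i2 == i)))%N.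
  by rewrite xE1 xE2 addnC expnD mulnA.
(* Two removals suffice unless they leave total exponent one, which the induction hypothesis
   excludes; a third removal then leaves zero. *)
have [s2_1|s2_1] := eqVneq (\sum_i logn p (x2 i))%N 1%N; last first.
  have [] := IHn x2 => //.
  - by apply: (smaller _ _ i1 x2_gt0 xE); rewrite eqxx.
  - by move=> q q_pr; have [->//|ne] := eqVneq q p; rewrite -o2 // -o1 // x_good.
  move=> d [t dtE]; exists (fun q => d q * p ^ ((i1, i2) == q))%N, t => i.
  rewrite xE dtE /pair_triple_product.
  by rewrite (prod_mul_at _ d (fun q => (q.1 == i) + (q.2 == i)) (i1, i2))%N /= mulnAC.
have s2_gt0 : (0 < \sum_i logn p (x2 i))%N by rewrite s2_1.
have [i3 [x3 [x3_gt0 xE3 s3 o3]]] := logn_sum_factor _ _ x2_gt0 p_pr s2_gt0.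
have {}xE i : (x i = x3 i * p ^ ((i1 == i) + (i2 == i) + (i3 == i)))%N.
  by rewrite xE xE3 [in RHS]addnC [in RHS]expnD mulnA.
have [] := IHn x3 => //.
- by apply: (smaller _ _ i1 x3_gt0 xE); rewrite eqxx.
- move=> q q_pr; have [->|ne] := eqVneq q p; first by lia.
  by rewrite -o3 // -o2 // -o1 // x_good.
move=> d [t dtE]; exists d, (fun q => t q * p ^ ((i1, i2, i3) == q))%N => i.
rewrite xE dtE /pair_triple_product.
by rewrite (prod_mul_at _ t (fun q => (q.1.1 == i) + (q.1.2 == i) + (q.2 == i)) (i1, i2, i3))%N
  mulnA.
Qed.
End Decomposition.

(** * Sums of reciprocals *)

Definition recip_den (J : finType) (x : J -> nat) : nat := (\prod_j x j)%N.
Definition recip_num (J : finType) (x : J -> nat) : nat :=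
  (\sum_i \prod_(j | j != i) x j)%N.

(** Every term of [recip_num J x] except the one omitting [i] is divisible by [p]. So [p] divides
    the denominator of the first fraction but not its numerator, and it must divide the denominator
    of the second. *)
Lemma recip_eq_no_lone_prime (J : finType) (x y : J -> nat) (p : nat) (i : J) :
  prime p -> (recip_num J x * recip_den J y = recip_num J y * recip_den J x)%N ->
  (p %| x i)%N -> (forall j, j != i -> ~~ (p %| x j)%N) ->
  ~ (forall j, ~~ (p %| y j)%N).
Proof.
move=> p_pr eq_xy p_xi p_x p_y.
have ndvd_prod (P : pred J) (z : J -> nat) :
    (forall j, P j -> ~~ (p %| z j)%N) -> ~~ (p %| \prod_(j | P j) z j)%N.
  move=> ndvd; elim/big_rec: _ => [|j n Pj IH]; first by rewrite gtnNdvd ?prime_gt1.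
  by rewrite Euclid_dvdM // negb_or ndvd.
have : (p %| recip_num J x * recip_den J y)%N.
  by rewrite eq_xy dvdn_mull // /recip_den (bigD1 i) //= dvdn_mulr.
rewrite Euclid_dvdM // (negPf (ndvd_prod xpredT y (fun j _ => p_y j))) orbF.
rewrite /recip_num (bigD1 i) //= dvdn_addl; first exact/negP/ndvd_prod.
by apply: dvdn_sum => j ne_ji; rewrite (bigD1 i) 1?eq_sym //= dvdn_mulr.
Qed.

(** A prime of total exponent one would divide a single coordinate, on one side of the equation,
    against [recip_eq_no_lone_prime]. *)
Lemma recip_eq_decomposition (J : finType) (x : J + J -> nat) :
  (forall i, 0 < x i)%N ->
  (recip_num J (x \o inl) * recip_den J (x \o inr) =
   recip_num J (x \o inr) * recip_den J (x \o inl))%N ->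
  exists d t, forall i, x i = pair_triple_product (J + J)%type d t i.
Proof.
move=> x_gt0 eq_x; apply: pair_triple_decomposition => // p p_pr.
apply/negP => /eqP s1.
have [i p_xi] : exists i, (p %| x i)%N.
  apply/existsP; apply: contraT => /existsPn p_x; move: s1.
  rewrite big1 // => i _; apply/eqP; rewrite -leqn0 leqNgt logn_gt0 mem_primes.
  by rewrite negb_and negb_and (p_x i) !orbT.
have p_x j : j != i -> ~~ (p %| x j)%N.
  move=> ne_ji; apply/negP => p_xj; move: s1.
  rewrite (bigD1 i) //= (bigD1 j) //=.
  have : (0 < logn p (x i))%N by rewrite logn_gt0 mem_primes p_pr x_gt0.
  have : (0 < logn p (x j))%N by rewrite logn_gt0 mem_primes p_pr x_gt0.
  by lia.
case: i p_xi p_x => i p_xi p_x.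
- by apply: (recip_eq_no_lone_prime _ _ _ _ i p_pr eq_x) => // j; [move=> ne|]; apply: p_x.
- by apply: (recip_eq_no_lone_prime _ _ _ _ i p_pr (esym eq_x)) => // j; [move=> ne|]; apply: p_x.
Qed.

(* The fractions [C1 / E1] and [C2 / E2] are equal or at least [m / Y ^ 2] apart. *)
Lemma floor_ratio_separation (m Y C1 E1 C2 E2 : nat) :
  (0 < m)%N -> (0 < E1 <= Y)%N -> (0 < E2 <= Y)%N ->
  (C1 * Y ^ 2 %/ (E1 * m) = C2 * Y ^ 2 %/ (E2 * m))%N ->
  (C1 * E2 = C2 * E1 %[mod m])%N -> (C1 * E2 = C2 * E1)%N.
Proof.
have sub_lt (x y u v w : nat) :
    (x < u -> v <= y -> u = v + w -> 0 < w -> x - y < w)%N by lia.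
move=> m_gt0; wlog le12 : C1 E1 C2 E2 / (C1 * E2 <= C2 * E1)%N => [H E1Y E2Y e c|].
  by case/orP: (leq_total (C1 * E2) (C2 * E1)) => le; [|symmetry]; apply: H.
move=> /andP[E1_gt0 E1Y] /andP[E2_gt0 E2Y] eq_q /eqP.
rewrite eq_sym eqn_mod_dvd // => m_dvd.
have lt1 : (C2 * Y ^ 2 < (C2 * Y ^ 2 %/ (E2 * m)).+1 * (E2 * m))%N.
  by rewrite ltn_ceil // muln_gt0 E2_gt0.
have le1 : (C1 * Y ^ 2 %/ (E1 * m) * (E1 * m) <= C1 * Y ^ 2)%N by exact: leq_divM.
rewrite eq_q in le1; move: (C2 * Y ^ 2 %/ (E2 * m))%N lt1 le1 => q lt1 le1.
have Y_gt0 : (0 < Y)%N by apply: leq_trans E1Y.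
(* Both ratios [C * Y ^ 2 / (E * m)] lie between [q] and [q + 1], so [C2 * E1 - C1 * E2 < m * E1 *
   E2 / Y ^ 2 <= m]. *)
have lt_m : (C2 * E1 - C1 * E2 < m)%N.
  have a1 : (C2 * Y ^ 2 * E1 < q.+1 * (E2 * m) * E1)%N by rewrite ltn_pmul2r.
  have a2 : (q * (E1 * m) * E2 <= C1 * Y ^ 2 * E2)%N by rewrite leq_pmul2r.
  have a3 : (E1 * E2 * m <= Y ^ 2 * m)%N by rewrite leq_pmul2r // -mulnn leq_mul.
  rewrite -(ltn_pmul2l (_ : 0 < Y ^ 2)%N) ?expn_gt0 ?Y_gt0 // mulnBr.
  apply: leq_trans a3.
  have -> : (Y ^ 2 * (C2 * E1) = C2 * Y ^ 2 * E1)%N by ring.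
  have -> : (Y ^ 2 * (C1 * E2) = C1 * Y ^ 2 * E2)%N by ring.
  apply: sub_lt a1 a2 _ _; first by ring.
  by rewrite !muln_gt0 E1_gt0 E2_gt0.
have : (C2 * E1 - C1 * E2 = 0)%N.
  by apply/eqP; apply: contraLR m_dvd; rewrite -lt0n => gt0; rewrite gtnNdvd.
by move/eqP; rewrite subn_eq0 => le21; apply/eqP; rewrite eqn_leq le12.
Qed.

(* Slopes below [X / Y] and above [X / Y] are discretised separately, the
   latter through their inverses. *)
Definition slope_bucket (m X Y A B : nat) : bool * 'I_(X * Y %/ m).+1 :=
  if (A * Y <= X * B)%N then (true, inord (A * Y ^ 2 %/ (B * m)))
  else (false, inord (B * X ^ 2 %/ (A * m))).

(** In either branch the quotient is at most [X * Y / m], so [inord] loses nothing. A single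
    discretisation would need about [X * Y ^ 2 / m] buckets, because slopes may be as large as
    [X]. *)
Lemma slope_bucket_inj (m X Y A1 B1 A2 B2 : nat) :
  (0 < m)%N -> (0 < B1 <= Y)%N -> (0 < B2 <= Y)%N -> (A1 <= X)%N -> (A2 <= X)%N ->
  slope_bucket m X Y A1 B1 = slope_bucket m X Y A2 B2 ->
  (A1 * B2 = A2 * B1 %[mod m])%N -> (A1 * B2 = A2 * B1)%N.
Proof.
move=> m_gt0 B1Y B2Y A1X A2X.
have bound A B U V : (0 < B)%N -> (A * V <= U * B)%N ->
    (A * V ^ 2 %/ (B * m) < (U * V %/ m).+1)%N.
  move=> B_gt0 le; rewrite ltnS -[X in (_ <= X)%N](divnMl B_gt0) leq_div2r //.
  by rewrite -mulnn mulnA (mulnCA B) mulnA leq_mul.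
have pos A B : (X * B < A * Y)%N -> (0 < A)%N by case: A.
have inord_eq a b : (a < (X * Y %/ m).+1)%N -> (b < (X * Y %/ m).+1)%N ->
    inord a = inord b :> 'I_(X * Y %/ m).+1 -> a = b.
  by move=> lta ltb /(congr1 val) /=; rewrite !inordK.
have [/andP[B1_gt0 _] /andP[B2_gt0 _]] := (B1Y, B2Y).
rewrite /slope_bucket.
case: leqP => [le1|lt1]; case: leqP => [le2|lt2] //.
  by case=> /inord_eq; rewrite !bound // => /(_ isT isT); apply: floor_ratio_separation.
have bound' A B : (X * B < A * Y)%N -> (B * X ^ 2 %/ (A * m) < (X * Y %/ m).+1)%N.
  move=> lt; rewrite (mulnC X Y) bound ?(pos _ _ lt) //.
  by rewrite mulnC (mulnC Y) ltnW.
case=> /inord_eq; rewrite !bound' // => /(_ isT isT) e c.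
rewrite [LHS]mulnC [RHS]mulnC; symmetry.
apply: (floor_ratio_separation m X) m_gt0 _ _ e _.
- by rewrite (pos _ _ lt1).
- by rewrite (pos _ _ lt2).
- by rewrite [X in X %% _]mulnC [X in _ = X %% _]mulnC c.
Qed.

Local Open Scope ring_scope.

(** * Counting tuples without a lone prime *)

Lemma prod_Xnat (R : comNzRingType) (I K : finType) (F : K -> R) (e : K -> I -> nat) :
  \prod_i \prod_q F q ^+ e q i = \prod_q F q ^+ (\sum_i e q i)%N.
Proof. by rewrite exchange_big /=; apply: eq_bigr => q _; rewrite prodrXr. Qed.

Lemma sum_eq1 (I : finType) (j : I) : (\sum_i (j == i) = 1)%N.
Proof. by rewrite (bigD1 j) //= eqxx big1 // => i /negPf ne; rewrite eq_sym ne. Qed.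

(* Rankin's trick: each [x] is weighted by [\prod_i sqrt (N / x i) >= 1].  A pair
   factor [d] occurs in two of the coordinates and so contributes [1 / d], which
   costs a logarithm; a triple factor [t] contributes [t ^ (- 3 / 2)]. *)
Lemma card_pair_triple_product (R : rcfType) (I : finType) (N : nat)
    (P : pred {ffun I -> 'I_N}) :
  (forall x, P x -> exists d t, forall i, (x i).+1 = pair_triple_product I d t i) ->
  #|P|%:R <= Num.sqrt N%:R ^+ #|I|
     * (\sum_(d < N) (d.+1%:R : R)^-1) ^+ (#|I| ^ 2)
     * (\sum_(t < N) (t.+1%:R * Num.sqrt (t.+1%:R : R))^-1) ^+ (#|I| ^ 3).
Proof.
move=> rep.
pose s (n : nat) : R := Num.sqrt n%:R.
have s_gt0 n : 0 < s n.+1 by rewrite sqrtr_gt0 ltr0n.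
have s1 : s 1%N = 1 by rewrite /s sqrtr1.
have sM a b : s (a * b)%N = s a * s b by rewrite /s natrM sqrtrM ?ler0n.
have sX a n : s (a ^ n)%N = s a ^+ n.
  by elim: n => [|n IHn]; rewrite ?expn0 // expnS sM IHn exprS.
have s_prod (J : finType) (F : J -> nat) : s (\prod_j F j)%N = \prod_j s (F j).
  by elim/big_rec2: _ => // j a b _ <-; rewrite sM.
have sqs n : s n ^+ 2 = n%:R by rewrite sqr_sqrtr ?ler0n.
pose dt := ({ffun I * I -> 'I_N} * {ffun I * I * I -> 'I_N})%type.
pose matches (x : {ffun I -> 'I_N}) (q : dt) :=
  [forall i, (x i).+1 == pair_triple_product I (fun j => (q.1 j).+1) (fun j => (q.2 j).+1) i].
have matched x : P x -> exists q, matches x q.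
  move=> /rep[d [t xE]].
  (* A factor divides the first coordinate of its index, so it is at most [N] and is coded by an
     ordinal shifted by one. *)
  have d_dvd j : (0 < d j)%N /\ ((d j).-1 < N)%N.
    have : (d j %| (x j.1).+1)%N.
      rewrite xE /pair_triple_product dvdn_mulr // (bigD1 j) //= dvdn_mulr //.
      by rewrite eqxx dvdn_exp.
    case: (d j) => [|n]; first by rewrite dvd0n.
    by move=> /dvdn_leq -/(_ isT) /leq_trans -/(_ _ (ltn_ord _)).
  have t_dvd j : (0 < t j)%N /\ ((t j).-1 < N)%N.
    have : (t j %| (x j.2).+1)%N.
      rewrite xE /pair_triple_product dvdn_mull // (bigD1 j) //= dvdn_mulr //.
      by rewrite eqxx dvdn_exp // addn1.
    case: (t j) => [|n]; first by rewrite dvd0n.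
    by move=> /dvdn_leq -/(_ isT) /leq_trans -/(_ _ (ltn_ord _)).
  exists ([ffun j => Ordinal (d_dvd j).2], [ffun j => Ordinal (t_dvd j).2]).
  apply/forallP => i; apply/eqP; rewrite xE /pair_triple_product /=.
  by congr (_ * _)%N; apply: eq_bigr => j _; rewrite ffunE /= prednK //;
    first [case: (d_dvd j) | case: (t_dvd j)].
(* An element of [P] supplies the default value in [h]; for empty [P] the bound is trivial. *)
have [x0 Px0|P0] := pickP P; last first.
  by rewrite eq_card0 // !mulr_ge0 ?exprn_ge0 ?sqrtr_ge0 // sumr_ge0 // => j _;
    rewrite invr_ge0 ?mulr_ge0 ?sqrtr_ge0.
have [q0 _] := matched _ Px0.
pose h x : dt := odflt q0 [pick q | matches x q].
have hP x : P x -> matches x (h x).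
  by move=> /matched[q qx]; rewrite /h; case: pickP => [//|/(_ q)/idP].
pose W (q : dt) : R := \prod_j ((q.1 j).+1%:R)^-1 *
  \prod_j ((q.2 j).+1%:R * s (q.2 j).+1)^-1.
have W_ge0 q : 0 <= W q.
  rewrite mulr_ge0 // prodr_ge0 // => j _; rewrite invr_ge0 ?ler0n //.
  by rewrite mulr_ge0 ?ler0n // ltW.
(* Each pair factor has total exponent two and contributes [sqrt d ^ 2 = d]; each triple factor
   contributes [sqrt t ^ 3 = t * sqrt t]. *)
have WE x q : matches x q -> \prod_i (s (x i).+1)^-1 = W q.
  move=> /forallP xE; rewrite /W !prodfV -invfM; congr (_^-1).
  under eq_bigr => i _ do rewrite (eqP (xE i)) /pair_triple_product sM !s_prod.
  under eq_bigr => i _.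
    under eq_bigr => j _ do rewrite sX.
    under [X in _ * X]eq_bigr => j _ do rewrite sX.
    over.
  rewrite big_split /= !prod_Xnat; congr (_ * _); apply: eq_bigr => j _.
    by rewrite big_split /= !sum_eq1 sqs.
  by rewrite !big_split /= !sum_eq1 exprS sqs mulrC.
have sumW : \sum_q W q = (\sum_(d < N) (d.+1%:R : R)^-1) ^+ (#|I| ^ 2)
     * (\sum_(t < N) (t.+1%:R * Num.sqrt (t.+1%:R : R))^-1) ^+ (#|I| ^ 3).
  rewrite /W -(pair_bigA _ (fun (d : {ffun I * I -> 'I_N}) (t : {ffun I * I * I -> 'I_N}) =>
    \prod_j ((d j).+1%:R)^-1 * \prod_j ((t j).+1%:R * s (t j).+1)^-1)) /=.
  rewrite -big_distrlr /= -(bigA_distr_bigA (fun _ (d : 'I_N) => (d.+1%:R : R)^-1)).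
  rewrite -(bigA_distr_bigA (fun _ (d : 'I_N) => (d.+1%:R * s d.+1)^-1)).
  by rewrite !prodr_const !card_prod (expnSr _ 2) -mulnn. 
have term x : 1 <= \prod_(i : I) (s N / s (x i : 'I_N).+1).
  apply: (@le_trans _ _ (\prod_(i : I) 1)); first by rewrite big1_eq.
  apply: ler_prod => i _.
  by rewrite ler01 ler_pdivlMr // mul1r ler_sqrt ?ler_nat ?ler0n // ltn_ord.
rewrite -mulrA -sumW -sum1_card natr_sum.
apply: (@le_trans _ _ (\sum_(x | P x) s N ^+ #|I| * \prod_i (s (x i).+1)^-1)).
  apply: ler_sum => x _; apply: le_trans (term x) _.
  by rewrite big_split /= prodr_const.
rewrite -mulr_sumr ler_wpM2l ?exprn_ge0 ?sqrtr_ge0 //.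
(* A tuple is recovered from its factors, so its weights can be summed over all of [dt]. *)
have hinj : {in P &, injective h}.
  move=> x y /hP mx /hP my hxy; apply/ffunP => i.
  move/forallP/(_ i)/eqP: mx; move/forallP/(_ i)/eqP: my.
  by rewrite hxy => <- /succn_inj/val_inj.
rewrite (eq_bigr (fun x => W (h x))) => [|x /hP]; last exact: WE.
rewrite -(big_imset W hinj) /= [X in _ <= X](bigID [in h @: P]) /= lerDl.
exact: sumr_ge0.
Qed.

(** Induction, with [ln (1 - e) <= - e] for [e = 1 / (N + 2)]. *)
Lemma harmonic_le_ln (R : realType) (N : nat) :
  (0 < N)%N -> \sum_(d < N) (d.+1%:R : R)^-1 <= 1 + ln N%:R.
Proof.
case: N => // N _; elim: N => [|N IHN]; first by rewrite big_ord1 ln1 invr1 addr0.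
rewrite big_ord_recr /=; apply: (le_trans (lerD IHN (lexx _))).
have N2 : (0 : R) < N.+2%:R by rewrite ltr0n.
have N1 : (0 : R) < N.+1%:R by rewrite ltr0n.
have E : N.+1%:R = N.+2%:R * (1 + - (N.+2%:R)^-1) :> R.
  by rewrite mulrDr mulr1 mulrN divff ?gt_eqF // -(natr1 N.+1) addrK.
have gt0 : 0 < 1 + - (N.+2%:R : R)^-1 by move: N1; rewrite E pmulr_rgt0.
rewrite E lnM ?posrE //; move: gt0; set e := _^-1 => gt0.
have e1 : -1 < - e by lra.
by have := le_ln1Dx e1; lra.
Qed.

(** Telescoping: for [a = sqrt n] and [b = sqrt (n + 1)], [2 / a - 2 / b = 2 / (a * b * (a + b)) >=
    1 / b ^ 3]. *)
Lemma sum_inv_n_sqrt_le3 (R : rcfType) (N : nat) :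
  \sum_(t < N) (t.+1%:R * Num.sqrt (t.+1%:R : R))^-1 <= 3.
Proof.
case: N => [|N]; first by rewrite big_ord0.
have step (a b : R) : 0 < a -> 0 < b -> b ^+ 2 = a ^+ 2 + 1 ->
    (b ^+ 2 * b)^-1 <= 2 / a - 2 / b.
  move=> a0 b0 ab.
  have le_ab : a <= b by rewrite -(ler_pXn2r (n := 2) isT) ?nnegrE ?(ltW a0) ?(ltW b0) // ab lerDl.
  have -> : 2 / a - 2 / b = 2 / (a * b * (a + b)).
    have one : (b - a) * (a + b) = 1.
      have -> : (b - a) * (a + b) = b ^+ 2 - a ^+ 2 by ring.
      by rewrite ab addrAC subrr add0r.
    rewrite -[X in X / (_ * (_ + _))]mulr1 -one.
    by field; rewrite !gt_eqF ?addr_gt0.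
  rewrite -[X in X <= _]mul1r ler_pdivrMr ?mulr_gt0 ?exprn_gt0 //.
  rewrite mulrAC ler_pdivlMr ?mulr_gt0 ?addr_gt0 // mul1r.
  have -> : 2 * (b ^+ 2 * b) = b * (b * (b + b)) by ring.
  rewrite -[a * b * _]mulrA mulrCA ler_wpM2l ?(ltW b0) //.
  by rewrite ler_pM ?(ltW a0) ?addr_ge0 ?lerD ?(ltW a0) ?(ltW b0).
suff : \sum_(t < N.+1) (t.+1%:R * Num.sqrt (t.+1%:R : R))^-1
   <= 3 - 2 / Num.sqrt N.+1%:R.
  by move/le_trans; apply; rewrite gerBl divr_ge0 ?sqrtr_ge0.
elim: N => [|N IHN].
  by rewrite big_ord1 /= sqrtr1 mul1r invr1 mulr1; lra.
rewrite big_ord_recr /=; apply: (le_trans (lerD IHN (lexx _))).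
have := step (Num.sqrt N.+1%:R) (Num.sqrt N.+2%:R).
rewrite !sqrtr_gt0 !ltr0n !sqr_sqrtr ?ler0n // natr1 => /(_ isT isT erefl) le.
by rewrite -addrA lerD2l addrC lerBlDr [X in _ <= X]addrC.
Qed.

(** * Sums of inverses modulo m *)

(** Each [a i ^ k.+1] lies above the tangent at the mean [M], and the linear terms cancel in the
    sum. *)
Lemma power_mean_sum (R : realFieldType) (I : finType) (a : I -> R) (k : nat) :
  (forall i, 0 <= a i) -> (\sum_i a i) ^+ k.+1 <= #|I|%:R ^+ k * \sum_i a i ^+ k.+1.
Proof.
move=> a_ge0.
have tangent (x M : R) n : 0 <= x -> 0 <= M -> M ^+ n.+1 + n.+1%:R * M ^+ n * (x - M) <= x ^+ n.+1.
  move=> x0 M0; elim: n => [|n IHn]; first by rewrite !expr1 expr0 mulr1 mul1r addrC subrK.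
  have := ler_wpM2l x0 IHn; rewrite -exprS; apply: le_trans.
  have : 0 <= n.+1%:R * M ^+ n * (x - M) ^+ 2.
    by rewrite mulr_ge0 ?sqr_ge0 // mulr_ge0 ?exprn_ge0.
  rewrite -(natr1 n.+1) !exprS; move: (n.+1%:R) (M ^+ n) => c P; lra.
have [I0|I_gt0] := posnP #|I|.
  by rewrite !big_pred0 ?expr0n ?mulr0 // => i; have := fintype0 i I0.
set S := \sum_i a i; have S0 : 0 <= S by apply: sumr_ge0 => i _; exact: a_ge0.
have n0 : (0 : R) < #|I|%:R by rewrite ltr0n.
pose M := S / #|I|%:R; have M0 : 0 <= M by rewrite divr_ge0 // ltW.
have SE : S = #|I|%:R * M by rewrite mulrC divfK ?gt_eqF.
have := ler_sum (index_enum I) (fun i (_ : true) => tangent (a i) M k (a_ge0 i) M0).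
rewrite big_split /= sumr_const -mulr_sumr sumrB sumr_const -/S.
rewrite -[M *+ _]mulr_natl -SE subrr mulr0 addr0 => le.
rewrite SE exprMn exprS -mulrA mulrCA ler_wpM2l ?exprn_ge0 ?(ltW n0) //.
by rewrite mulr_natl.
Qed.

Lemma cauchy_schwarz_sum (R : realFieldType) (I : finType) (a b : I -> R) :
  (\sum_i a i * b i) ^+ 2 <= (\sum_i a i ^+ 2) * (\sum_i b i ^+ 2).
Proof.
set A := \sum_i a i ^+ 2; set B := \sum_i b i ^+ 2; set C := \sum_i a i * b i.
have B0 : 0 <= B by apply: sumr_ge0 => i _; exact: sqr_ge0.
have Q (t : R) : 0 <= A - 2 * t * C + t ^+ 2 * B.
  have -> : A - 2 * t * C + t ^+ 2 * B = \sum_i (a i - t * b i) ^+ 2.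
    rewrite !mulr_sumr -sumrB -big_split /=; apply: eq_bigr => i _; ring.
  by apply: sumr_ge0 => i _; exact: sqr_ge0.
have [B_0|B_gt0] := eqVneq B 0.
  suff -> : C = 0 by rewrite B_0 mulr0 expr0n.
  apply: big1 => i _; move: B_0; rewrite /B => /psumr_eq0P.
  by move=> /(_ (fun i _ => sqr_ge0 _))/(_ i isT)/eqP; rewrite sqrf_eq0 => /eqP->; rewrite mulr0.
have {}B_gt0 : 0 < B by rewrite lt0r B_gt0.
have := ler_wpM2r B0 (Q (C / B)).
have -> : (A - 2 * (C / B) * C + (C / B) ^+ 2 * B) * B = A * B - C ^+ 2.
  by field; rewrite gt_eqF.
lra.
Qed.

Lemma card_eq_pairs (Y K : finType) (h : Y -> K) :
  #|[pred y : Y * Y | h y.1 == h y.2]| = (\sum_c #|[pred y | h y == c]| ^ 2)%N.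
Proof.
rewrite -sum1_card (partition_big (fun y : Y * Y => h y.1) xpredT) //=.
apply: eq_bigr => c _; rewrite -mulnn -cardX -sum1_card; apply: eq_bigl => -[y z].
by rewrite !inE /= andbC; case: eqP => //= ->; rewrite eq_sym.
Qed.

(** Cauchy-Schwarz: [g] cuts each fibre of [f] into at most [#|G|] pieces. *)
Lemma card_fiber_pairs (Y F G : finType) (f : Y -> F) (g : Y -> G) :
  (#|[pred y : Y * Y | f y.1 == f y.2]| <=
   #|G| * #|[pred y : Y * Y | (f y.1 == f y.2) && (g y.1 == g y.2)]|)%N.
Proof.
pose fg y := (f y, g y).
have -> : #|[pred y : Y * Y | (f y.1 == f y.2) && (g y.1 == g y.2)]| =
          #|[pred y : Y * Y | fg y.1 == fg y.2]|.
  by apply: eq_card => y; rewrite !inE.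
rewrite !card_eq_pairs -(ler_nat rat) natrM !natr_sum mulr_sumr.
under [X in _ <= X]eq_bigr do rewrite natrX.
rewrite -(pair_bigA _ (fun c d => #|G|%:R * #|[pred y | fg y == (c, d)]|%:R ^+ 2)) /=.
apply: ler_sum => c _; rewrite natrX -mulr_sumr.
have -> : #|[pred y | f y == c]|%:R = \sum_d #|[pred y | fg y == (c, d)]|%:R :> rat.
  rewrite -natr_sum -sum1_card (partition_big g xpredT) //=; congr (_%:R).
  by apply: eq_bigr => d _; rewrite sum1dep_card; apply: eq_card => y; rewrite !inE /fg xpair_eqE.
by have := @power_mean_sum rat G (fun d => #|[pred y | fg y == (c, d)]|%:R) 1; rewrite expr1; apply.
Qed.

(** The ordinal [x] stands for the integer [x.+1], so that the range is [1, N]. *)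
Definition coprime_ord (N m : nat) := {x : 'I_N | coprime x.+1 m}.
Definition tuple_val (N m : nat) (J : finType) (y : {ffun J -> coprime_ord N m}) (j : J) : nat :=
  (val (val (y j))).+1.
Definition sum_inv (N m : nat) (J : finType) (y : {ffun J -> coprime_ord N m}) : 'Z_m :=
  \sum_j (tuple_val N m J y j)%:R^-1.

Definition sum_inv_pairs (N m k : nat) :
    {pred {ffun 'I_k -> coprime_ord N m} * {ffun 'I_k -> coprime_ord N m}} :=
  [pred y | sum_inv N m _ y.1 == sum_inv N m _ y.2].

(** Equality of the two rational sums of reciprocals, cross-multiplied to stay in [nat]. *)
Definition recip_eq_pairs (N m k : nat) :
    {pred {ffun 'I_k -> coprime_ord N m} * {ffun 'I_k -> coprime_ord N m}} :=
  [pred y | recip_num _ (tuple_val N m _ y.1) * recip_den _ (tuple_val N m _ y.2) ==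
      recip_num _ (tuple_val N m _ y.2) * recip_den _ (tuple_val N m _ y.1)]%N.

Lemma sum_inv_clear_den (N m : nat) (J : finType) (y : {ffun J -> coprime_ord N m}) :
  (1 < m)%N ->
  (recip_num J (tuple_val N m J y))%:R = sum_inv N m J y * (recip_den J (tuple_val N m J y))%:R.
Proof.
move=> m_gt1; rewrite natr_sum mulr_suml; apply: eq_bigr => j _.
rewrite /recip_den [in RHS](bigD1 j) //= natrM mulKr // unitZpE // coprime_sym.
exact: (valP (y j)).
Qed.

(** [card_fiber_pairs] applied to the bucket map: tuples with congruent sums in one bucket have
    equal rational sums. [X] and [Y] bound the numerators and denominators. *)
Lemma card_sum_inv_pairs (N m k : nat) : (1 < m)%N ->
  (#|sum_inv_pairs N m k| <=
   2 * (k * N ^ k.-1 * N ^ k %/ m).+1 * #|recip_eq_pairs N m k|)%N.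
Proof.
move=> m_gt1; set X := (k * N ^ k.-1)%N; set Y := (N ^ k)%N.
pose g (y : {ffun 'I_k -> coprime_ord N m}) :=
  slope_bucket m X Y (recip_num _ (tuple_val N m _ y)) (recip_den _ (tuple_val N m _ y)).
apply: leq_trans (card_fiber_pairs _ _ _ (sum_inv N m 'I_k) g) _.
rewrite card_prod card_bool card_ord leq_mul2l; apply/orP; right.
apply/subset_leq_card/subsetP => -[y z]; rewrite !inE /= => /andP[/eqP eq_f /eqP eq_g].
have val_le (w : {ffun 'I_k -> coprime_ord N m}) j : (0 < tuple_val N m _ w j <= N)%N.
  by rewrite /tuple_val /= ltn_ord.
have den_le w : (0 < recip_den _ (tuple_val N m 'I_k w) <= Y)%N.
  rewrite prodn_gt0 => [|j]; last by case/andP: (val_le w j).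
  have -> : Y = (\prod_(j < k) N)%N by rewrite prod_nat_const card_ord.
  by apply: leq_prod => j _; case/andP: (val_le w j).
have num_le w : (recip_num _ (tuple_val N m 'I_k w) <= X)%N.
  have -> : X = (\sum_(j < k) N ^ k.-1)%N by rewrite sum_nat_const card_ord.
  apply: leq_sum => i _.
  have -> : (N ^ k.-1 = \prod_(j < k | j != i) N)%N by rewrite prod_nat_const cardC1 card_ord.
  by apply: leq_prod => j _; case/andP: (val_le w j).
apply/eqP; apply: slope_bucket_inj eq_g _; rewrite ?den_le ?num_le ?(ltnW m_gt1) //.
rewrite -!val_Zp_nat // !natrM !sum_inv_clear_den // eq_f.
by rewrite mulrAC.
Qed.

Lemma card_coprime_ord (N m : nat) : (#|{: coprime_ord N m}| <= N)%N.
Proof. by rewrite card_sig (leq_trans (max_card _)) ?card_ord. Qed.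

(** The two tuples are joined into one with [2 * k] coordinates, and coprimality to [m] is
    forgotten. *)
Lemma card_recip_eq_pairs (R : realType) (N m k : nat) : (0 < N)%N ->
  #|recip_eq_pairs N m k|%:R <=
  N%:R ^+ k * (1 + ln (N%:R : R)) ^+ ((2 * k) ^ 2) * 3 ^+ ((2 * k) ^ 3).
Proof.
move=> N_gt0; pose I : finType := ('I_k + 'I_k)%type.
have cardI : #|I| = (2 * k)%N by rewrite card_sum card_ord addnn mul2n.
pose v (x : {ffun I -> 'I_N}) (i : I) := (val (x i)).+1.
pose P : pred {ffun I -> 'I_N} := fun x =>
  (recip_num _ (v x \o inl) * recip_den _ (v x \o inr) ==
   recip_num _ (v x \o inr) * recip_den _ (v x \o inl))%N.
have P_rep x : P x -> exists d t, forall i, (x i).+1 = pair_triple_product I d t i.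
  by move=> /eqP/recip_eq_decomposition; apply.
have := @card_pair_triple_product R I N P P_rep.
pose h (y : {ffun 'I_k -> coprime_ord N m} * {ffun 'I_k -> coprime_ord N m}) :
    {ffun I -> 'I_N} :=
  [ffun i : I => match i with inl j => val (y.1 j) | inr j => val (y.2 j) end].
have h_inj : injective h.
  move=> [y1 y2] [z1 z2] /ffunP hyz; congr (_, _); apply/ffunP => j; apply: val_inj.
    by have := hyz (inl j); rewrite !ffunE.
  by have := hyz (inr j); rewrite !ffunE.
have le_card : (#|recip_eq_pairs N m k| <= #|P|)%N.
  rewrite -(card_imset _ h_inj); apply/subset_leq_card/subsetP => _ /imsetP[y yP ->].
  have v1 : v (h y) \o inl =1 tuple_val N m _ y.1 by move=> j; rewrite /v /= ffunE.
  have v2 : v (h y) \o inr =1 tuple_val N m _ y.2 by move=> j; rewrite /v /= ffunE.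
  have numE (J : finType) (a b : J -> nat) : a =1 b -> recip_num J a = recip_num J b.
    by move=> ab; apply: eq_bigr => i _; apply: eq_bigr => j _; rewrite ab.
  have denE (J : finType) (a b : J -> nat) : a =1 b -> recip_den J a = recip_den J b.
    by move=> ab; apply: eq_bigr => j _; rewrite ab.
  by rewrite unfold_in /P (numE _ _ _ v1) (numE _ _ _ v2) (denE _ _ _ v1) (denE _ _ _ v2).
move: le_card; rewrite -(ler_nat R) => le_card /(le_trans le_card)/le_trans; apply.
have H0 : 0 <= \sum_(d < N) (d.+1%:R : R)^-1 by apply: sumr_ge0 => j _; rewrite invr_ge0.
have Z0 : 0 <= \sum_(t < N) (t.+1%:R * Num.sqrt (t.+1%:R : R))^-1.
  by apply: sumr_ge0 => j _; rewrite invr_ge0 mulr_ge0 ?sqrtr_ge0.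
rewrite cardI exprM sqr_sqrtr ?ler0n // ler_pM ?mulr_ge0 ?exprn_ge0 //.
  rewrite ler_wpM2l ?exprn_ge0 // lerXn2r ?nnegrE ?harmonic_le_ln //.
  by rewrite addr_ge0 // ln_ge0 // ler1n.
by rewrite lerXn2r ?nnegrE ?sum_inv_n_sqrt_le3.
Qed.

(** For [k = 1] only diagonal solutions exist. No logarithm of [N] appears, which matters when [N]
    exceeds [m]. *)
Lemma card_recip_eq_pairs1 (N m : nat) : (#|recip_eq_pairs N m 1| <= N)%N.
Proof.
have cardY : #|{: {ffun 'I_1 -> coprime_ord N m}}| = #|{: coprime_ord N m}|.
  by rewrite card_ffun card_ord expn1.
apply: leq_trans (card_coprime_ord N m); rewrite -cardY.
apply: (@leq_card_in _ _ fst) => -[y1 y2] [z1 z2]; rewrite !inE /=.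
rewrite /recip_num /recip_den !big_ord1 !big_pred0 => [|i|i|i|i]; rewrite ?ord1 //.
rewrite !mul1n => /eqP[eq_y] /eqP[eq_z] yz; rewrite yz in eq_y *; congr (_, _).
apply/ffunP => j; rewrite ord1; do 2!apply: val_inj.
by rewrite /= eq_y eq_z.
Qed.

(** From [ln (1 / 2) <= - 1 / 2] comes [ln 4 >= 1], the source of the threshold 4. *)
Lemma ln_nat_ge1 (R : realType) (m : nat) : (4 <= m)%N -> 1 <= ln (m%:R : R).
Proof.
move=> m4; have ln2 : 2^-1 <= ln (2 : R).
  have : -1 < - (2^-1 : R) by lra.
  move/le_ln1Dx; have -> : 1 + - 2^-1 = 2^-1 :> R by lra.
  by rewrite lnV ?posrE // lerN2.
apply: (@le_trans _ _ (ln (2 * 2 : R))); first by rewrite lnM ?posrE //; lra.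
by rewrite ler_ln ?posrE ?ltr0n -?natrM ?ler_nat // (leq_trans _ m4).
Qed.

Lemma sum_inv_pairs_bound (R : realType) (N m k : nat) : (4 <= m)%N -> (0 < N)%N -> (0 < k)%N ->
  #|sum_inv_pairs N m k|%:R <
  ((2 * k) ^ (90 * k ^ 3))%:R * ln (m%:R : R) ^+ (4 * k ^ 2)
  * (N%:R ^+ (2 * k - 1) / m%:R + 1) * N%:R ^+ k.
Proof.
move=> m4 N_gt0 k_gt0; set J := #|_|.
have L1 := ln_nat_ge1 R m m4; set L := ln _ in L1 *.
have m_gt0 : (0 : R) < m%:R by rewrite ltr0n (leq_trans _ m4).
have N1 : (1 : R) <= N%:R by rewrite ler1n.
have N0 : (0 : R) < N%:R by rewrite ltr0n.
(* The factor [2 * k] comes from the buckets, the power of 2 from [1 + ln N <= 2 * L], and the power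
   of 3 from the triple factors. *)
pose C : nat := (2 * k * (2 ^ (4 * k ^ 2) * 3 ^ (8 * k ^ 3)))%N.
have C_lt : (C < (2 * k) ^ (90 * k ^ 3))%N.
  (* Uses [2 <= 2 * k] and [3 <= (2 * k) ^ 2]; the exponent is at most [21 * k ^ 3], and the slack
     gives the strict inequality. *)
  apply: (@leq_ltn_trans ((2 * k) ^ (1 + (4 * k ^ 2 + 2 * (8 * k ^ 3))))).
    rewrite expnD expn1 leq_mul2l expnD; apply/orP; right.
    rewrite leq_mul //; first by rewrite leq_exp2r ?muln_gt0 ?expn_gt0 ?k_gt0 //; lia.
    rewrite [X in (_ <= X)%N]expnM leq_exp2r ?muln_gt0 ?expn_gt0 ?k_gt0 //; nia.
  rewrite ltn_exp2l; last by lia.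
  have : (k ^ 2 <= k ^ 3)%N by rewrite leq_pexp2l.
  have : (1 <= k ^ 3)%N by rewrite expn_gt0 k_gt0.
  lia.
set D := _ / m%:R + 1; have D1 : 1 <= D by rewrite lerDr divr_ge0 ?exprn_ge0 // ltW.
suff leJ : J%:R <= C%:R * L ^+ (4 * k ^ 2) * D * N%:R ^+ k.
  apply: (le_lt_trans leJ); rewrite -!mulrA ltr_pM2r ?ltr_nat //.
  by rewrite !mulr_gt0 ?exprn_gt0 // (lt_le_trans ltr01).
have L1X n : 1 <= L ^+ n by rewrite exprn_ege1.
have C2k : (2 * k <= C)%N by rewrite leq_pmulr // muln_gt0 !expn_gt0.
(* For [k >= 2] and [N >= m] the trivial bound [J <= N ^ (2 * k)] is enough. *)
have [small|big] := boolP ((k == 1) || (N < m))%N.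
  have T_le : #|recip_eq_pairs N m k|%:R <=
      N%:R ^+ k * (L ^+ (4 * k ^ 2) * (2 ^ (4 * k ^ 2) * 3 ^ (8 * k ^ 3))%:R) :> R.
    have [k1|k1] := eqVneq k 1%N.
      rewrite k1; apply: (@le_trans _ _ N%:R).
        by rewrite ler_nat card_recip_eq_pairs1.
      by rewrite expr1 ler_peMr // mulr_ege1 // ler1n muln_gt0 !expn_gt0.
    move: small; rewrite (negPf k1) /= => N_m.
    apply: le_trans (card_recip_eq_pairs R N m k N_gt0) _.
    have -> : ((2 * k) ^ 2 = 4 * k ^ 2)%N by rewrite expnMn.
    have -> : ((2 * k) ^ 3 = 8 * k ^ 3)%N by rewrite expnMn.
    rewrite natrM !natrX -!mulrA ler_wpM2l ?exprn_ge0 // !mulrA.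
    have lnN_le : ln (N%:R : R) <= L by rewrite ler_ln ?posrE // ler_nat ltnW.
    have lnN0 : 0 <= ln (N%:R : R) by rewrite ln_ge0.
    by rewrite ler_wpM2r ?exprn_ge0 // -exprMn lerXn2r ?nnegrE; lra.
  have := card_sum_inv_pairs N m k (leq_trans (isT : 1 < 4)%N m4).
  rewrite -/J -(ler_nat R) natrM => /le_trans; apply.
  have D_le : (2 * (k * N ^ k.-1 * N ^ k %/ m).+1)%:R <= (2 * k)%:R * D :> R.
    rewrite !natrM -mulrA ler_wpM2l // -natr1.
    apply: (@le_trans _ _ (k%:R * (N%:R ^+ (2 * k - 1) / m%:R) + 1)).
      rewrite lerD2r mulrA ler_pdivlMr // -natrX -!natrM ler_nat.
      apply: leq_trans (leq_divM _ _) _; rewrite -mulnA -expnD leq_mul2l.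
      by rewrite (_ : k.-1 + k = 2 * k - 1)%N ?leqnn ?orbT //; lia.
    by rewrite mulrDr mulr1 lerD2l ler1n.
  apply: le_trans (ler_pM _ _ D_le T_le) _; rewrite ?ler0n //.
  rewrite /C [in X in _ <= X]natrM; set a := (2 * k)%:R; set b := (_ * _)%:R.
  by rewrite le_eqVlt; apply/orP; left; apply/eqP; ring.
move: big; rewrite negb_or -leqNgt => /andP[k1 m_N].
have k2 : (2 <= k)%N by lia.
have J_le : (J <= N ^ (2 * k))%N.
  apply: (leq_trans (max_card _)); rewrite card_prod card_ffun card_ord mulnn -expnM mulnC.
  by rewrite leq_exp2r ?card_coprime_ord // muln_gt0.
apply: (@le_trans _ _ (N ^ (2 * k))%:R); first by rewrite ler_nat.
(* Since [m <= N], [N ^ (2 * k) * m <= N ^ (2 * k + 1) <= N ^ (3 * k - 1)] for [k >= 2]. *)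
have N_D : (N ^ (2 * k))%:R <= D * N%:R ^+ k.
  rewrite /D mulrDl mul1r ler_wpDr ?exprn_ge0 // mulrAC ler_pdivlMr //.
  rewrite -!natrX -!natrM ler_nat -expnD.
  apply: (@leq_trans (N ^ (2 * k) * N ^ 1)); first by rewrite expn1 leq_mul2l m_N orbT.
  by rewrite -expnD leq_pexp2l //; lia.
apply: (le_trans N_D); rewrite -!mulrA [X in _ <= X]mulrA ler_peMl //.
  by rewrite mulr_ge0 ?exprn_ge0 // (le_trans ler01).
by rewrite mulr_ege1 // ler1n (leq_trans _ C2k) // muln_gt0.
Qed.

Local Open Scope complex_scope.

(** * Bilinear sums over a finite ring *)

Section Bilinear.
Variable R : rcfType.
Local Notation C := R[i].
Implicit Types z w : C.

Lemma normCE z : `|z| = (normc z)%:C. Proof. by []. Qed.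

Lemma normc_ge0 z : 0 <= normc z.
Proof. by rewrite -lecR -normCE normr_ge0. Qed.

Lemma normc_real (r : R) : normc r%:C = `|r|.
Proof. by rewrite /normc /= expr0n addr0 sqrtr_sqr. Qed.

Lemma normc_sum (I : finType) (F : I -> C) : normc (\sum_i F i) <= \sum_i normc (F i).
Proof.
rewrite -lecR -normCE rmorph_sum /=; exact: ler_norm_sum.
Qed.

Lemma normc_prod_le1 (I : finType) (F : I -> C) :
  (forall i, normc (F i) <= 1) -> normc (\prod_i F i) <= 1.
Proof.
move=> F1; elim/big_rec: _ => [|i z _ IH]; first by rewrite normc1.
by rewrite normcM mulr_ile1 ?normc_ge0.
Qed.

Lemma normcX z n : normc (z ^+ n) = normc z ^+ n.
Proof. by elim: n => [|n IHn]; rewrite ?expr0 ?normc1 // !exprS normcM IHn. Qed.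

(** The factor rotating [z] onto the nonnegative reals; it turns absolute values into admissible
    coefficients. *)
Definition phase z : C := if z == 0 then 0 else (normc z)%:C / z.

Lemma phase_le1 z : normc (phase z) <= 1.
Proof.
rewrite /phase; case: eqVneq => [_|z0]; first by rewrite normc0.
have nz0 : normc z != 0 by apply: contra_neq z0; exact: eq0_normc.
by rewrite normcM normcV normc_real ger0_norm ?normc_ge0 // divff.
Qed.

Lemma phaseK z : phase z * z = (normc z)%:C.
Proof. by rewrite /phase; case: eqVneq => [->|z0]; rewrite ?mulr0 ?normc0 // divfK. Qed.

Variables (V : finComNzRingType) (psi : V -> C).
Hypothesis psiD : forall s t, psi (s + t) = psi s * psi t.
Hypothesis psi0 : psi 0 = 1.
Hypothesis psi_norm : forall s, normc (psi s) = 1.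
Hypothesis psi_orth : forall d, d != 0 -> \sum_l psi (l * d) = 0.

Definition bilinear_sum (X Y : finType) (u : X -> V) (v : Y -> V) (a : X -> C) (b : Y -> C) : C :=
  \sum_x \sum_y a x * b y * psi (u x * v y).

Definition tuple_sum (Y : finType) (v : Y -> V) (k : nat) (y : {ffun 'I_k -> Y}) : V :=
  \sum_j v (y j).

Lemma psi_sum (I : finType) (F : I -> V) : psi (\sum_i F i) = \prod_i psi (F i).
Proof. by elim/big_rec2: _ => // i z s _ <-; rewrite psiD. Qed.

(* The output is again a bilinear sum, with the two variables exchanged, so that
   the lemma can be applied twice. *)
Lemma bilinear_sum_power (X Y : finType) (u : X -> V) (v : Y -> V) (a : X -> C) (b : Y -> C) k :
  (forall x, normc (a x) <= 1) -> (forall y, normc (b y) <= 1) ->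
  exists (a' : X -> C) (b' : {ffun 'I_k.+1 -> Y} -> C),
    [/\ forall x, normc (a' x) <= 1, forall y, normc (b' y) <= 1 &
      normc (bilinear_sum X Y u v a b) ^+ k.+1 <=
      #|X|%:R ^+ k * normc (bilinear_sum _ _ (tuple_sum Y v k.+1) u b' a')].
Proof.
move=> a1 b1; pose B x := \sum_y b y * psi (u x * v y).
(* Expanding [B x ^+ k.+1] over tuples yields the coefficients [b']; the phase [a'] makes each power
   real, so the new sum equals the sum of [|B x| ^ k.+1]. *)
pose b' (y : {ffun 'I_k.+1 -> Y}) := \prod_j b (y j).
pose a' x := phase (B x ^+ k.+1).
exists a', b'; split=> [x|y|]; [exact: phase_le1 | exact: normc_prod_le1|].
have -> : bilinear_sum _ _ (tuple_sum Y v k.+1) u b' a' = (\sum_x normc (B x) ^+ k.+1)%:C.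
  rewrite /bilinear_sum exchange_big rmorph_sum /=; apply: eq_bigr => x _.
  rewrite -normcX -phaseK -/(a' x) /B.
  rewrite -[k.+1 in X in _ * X]card_ord -prodr_const.
  rewrite (bigA_distr_bigA (fun (_ : 'I_k.+1) y => b y * psi (u x * v y))) mulr_sumr.
  apply: eq_bigr => y _; rewrite big_split /= -/(b' y) -psi_sum -mulr_sumr.
  by rewrite -/(tuple_sum Y v k.+1 y) (mulrC (tuple_sum _ _ _ _)) mulrA (mulrC (b' y)).
rewrite normc_real ger0_norm; last first.
  by apply: sumr_ge0 => x _; rewrite exprn_ge0 ?normc_ge0.
apply: le_trans (power_mean_sum _ _ _ _ (fun x => normc_ge0 (B x))).
rewrite lerXn2r ?nnegrE ?normc_ge0 //; first by apply: sumr_ge0 => x _; exact: normc_ge0.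
apply: le_trans (normc_sum _ _) _; apply: ler_sum => x _.
have -> : \sum_y a x * b y * psi (u x * v y) = a x * B x.
  by rewrite mulr_sumr; apply: eq_bigr => y _; rewrite mulrA.
by rewrite normcM ler_piMl ?normc_ge0.
Qed.

Lemma psi_conj s : psi (- s) = (psi s)^*.
Proof.
have psi1 : psi s * psi (- s) = 1 by rewrite -psiD subrr.
have psi2 : psi s * (psi s)^* = 1 by rewrite -sqr_normc normCE psi_norm expr1n.
have psi_neq0 : psi s != 0 by apply: contra_eq_neq psi1 => ->; rewrite mul0r eq_sym oner_neq0.
by apply: (mulfI psi_neq0); rewrite psi1 psi2.
Qed.

(** Group the [x] by [l = u x] and apply Cauchy-Schwarz over [l]. Orthogonality then evaluates the
    mean square of [H] by pairs with equal [v]. *)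
Lemma bilinear_sum_sqr_le (X Y : finType) (u : X -> V) (v : Y -> V) (a : X -> C) (b : Y -> C) :
  (forall x, normc (a x) <= 1) -> (forall y, normc (b y) <= 1) ->
  normc (bilinear_sum X Y u v a b) ^+ 2 <=
  #|V|%:R * #|[pred x : X * X | u x.1 == u x.2]|%:R * #|[pred y : Y * Y | v y.1 == v y.2]|%:R.
Proof.
move=> a1 b1; pose H l := \sum_y b y * psi (l * v y).
have sumH : \sum_l normc (H l) ^+ 2 <= #|V|%:R * #|[pred y : Y * Y | v y.1 == v y.2]|%:R.
  have E : (\sum_l normc (H l) ^+ 2)%:C =
      \sum_(y : Y * Y) b y.1 * (b y.2)^* * \sum_l psi (l * (v y.1 - v y.2)).
    rewrite rmorph_sum /=; under [RHS]eq_bigr do rewrite mulr_sumr.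
    rewrite exchange_big /=; apply: eq_bigr => l _.
    rewrite rmorphXn /= -normCE sqr_normc /H rmorph_sum /= big_distrlr pair_bigA /=.
    apply: eq_bigr => -[y y'] _ /=; rewrite rmorphM /= -psi_conj mulrBr psiD.
    by rewrite mulrACA.
  rewrite -[X in X <= _]ger0_norm; last first.
    by apply: sumr_ge0 => l _; rewrite exprn_ge0 ?normc_ge0.
  rewrite -normc_real E; apply: le_trans (normc_sum _ _) _.
  rewrite mulrC mulr_natl -sumr_const [X in _ <= X]big_mkcond /=.
  apply: ler_sum => -[y y'] _ /=; rewrite !inE /=; case: eqVneq => [->|ne_v].
    rewrite subrr; under eq_bigr do rewrite mulr0 psi0.
    have -> : \sum_(l : V) 1 = (#|V|%:R)%:C :> C by rewrite sumr_const rmorph_nat.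
    rewrite !normcM normc_real normr_nat ler_piMl //.
    have -> : normc (b y')^* = normc (b y') by apply: complexI; rewrite -!normCE normcJ.
    by rewrite mulr_ile1 ?normc_ge0.
  by rewrite psi_orth ?subr_eq0 // mulr0 normc0.
have -> : bilinear_sum X Y u v a b = \sum_x a x * H (u x).
  by apply: eq_bigr => x _; rewrite mulr_sumr; apply: eq_bigr => y _; rewrite mulrA.
have le_I : normc (\sum_x a x * H (u x)) <= \sum_l #|[pred x | u x == l]|%:R * normc (H l).
  apply: le_trans (normc_sum _ _) _; rewrite (partition_big u xpredT) //=.
  apply: ler_sum => l _; rewrite mulr_natl -sumr_const.
  rewrite [X in _ <= X](eq_bigl (fun x => u x == l)) => [|x]; last by rewrite inE.
  by apply: ler_sum => x /eqP <-; rewrite normcM ler_piMl ?normc_ge0.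
apply: (@le_trans _ _ ((\sum_l #|[pred x | u x == l]|%:R * normc (H l)) ^+ 2)).
  rewrite lerXn2r ?nnegrE ?normc_ge0 //.
  by apply: sumr_ge0 => l _; rewrite mulr_ge0 ?normc_ge0.
apply: le_trans (cauchy_schwarz_sum _ _ _ _) _.
rewrite mulrAC [X in _ <= X]mulrC ler_pM //.
- by apply: sumr_ge0 => l _; exact: sqr_ge0.
- by apply: sumr_ge0 => l _; exact: sqr_ge0.
by rewrite card_eq_pairs natr_sum; apply: ler_sum => l _; rewrite natrX.
Qed.

(** The first power step replaces [y] by [l]-tuples, the second replaces [x] by [k]-tuples, and the
    square bound finishes. *)
Lemma bilinear_sum_bound (X Y : finType) (u : X -> V) (v : Y -> V) (a : X -> C) (b : Y -> C) k l :
  (0 < k)%N -> (0 < l)%N ->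
  (forall x, normc (a x) <= 1) -> (forall y, normc (b y) <= 1) ->
  normc (bilinear_sum X Y u v a b) ^+ (2 * k * l) <=
  #|X|%:R ^+ (2 * k * l.-1) * #|Y|%:R ^+ (2 * l * k.-1) * #|V|%:R
  * #|[pred x | tuple_sum X u k x.1 == tuple_sum X u k x.2]|%:R
  * #|[pred y | tuple_sum Y v l y.1 == tuple_sum Y v l y.2]|%:R.
Proof.
case: k l => // k [//|l] _ _ a1 b1.
have [a' [b' [a'1 b'1 le1]]] := bilinear_sum_power X Y u v a b l a1 b1.
have [c [d [c1 d1 le2]]] :=
  bilinear_sum_power _ _ (tuple_sum Y v l.+1) u b' a' k b'1 a'1.
have le3 := bilinear_sum_sqr_le _ _ (tuple_sum X u k.+1) (tuple_sum Y v l.+1) d c d1 c1.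
move: le1 le2 le3.
set S := normc (bilinear_sum X Y u v a b).
set S1 := normc (bilinear_sum _ _ _ _ b' a'); set S2 := normc (bilinear_sum _ _ _ _ d c).
move=> le1 le2 le3.
have [S0 S10 S20] : [/\ 0 <= S, 0 <= S1 & 0 <= S2] by rewrite !normc_ge0.
have -> : (2 * k.+1 * l.+1 = l.+1 * k.+1 * 2)%N by lia.
rewrite [S ^+ _]exprM [S ^+ (_ * _)]exprM.
apply: (@le_trans _ _ (((#|X|%:R ^+ l * S1) ^+ k.+1) ^+ 2)).
  by rewrite !lerXn2r ?nnegrE ?exprn_ge0 ?mulr_ge0 ?exprn_ge0.
rewrite [X in X <= _](_ : _ = #|X|%:R ^+ (l * (k.+1 * 2)) * S1 ^+ (k.+1 * 2)); last first.
  by rewrite !exprMn -!exprM mulnA.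
apply: (@le_trans _ _ (#|X|%:R ^+ (l * (k.+1 * 2)) * (#|{ffun 'I_l.+1 -> Y}|%:R ^+ k * S2) ^+ 2)).
  by rewrite ler_wpM2l ?exprn_ge0 // exprM lerXn2r ?nnegrE ?exprn_ge0 ?mulr_ge0 ?exprn_ge0.
rewrite exprMn -exprM card_ffun card_ord natrX -exprM /= -!mulrA.
have -> : (l * (k.+1 * 2) = 2 * k.+1 * l)%N by lia.
have -> : (l.+1 * (k * 2) = 2 * l.+1 * k)%N by lia.
by rewrite !ler_wpM2l ?exprn_ge0 // mulrA.
Qed.
End Bilinear.

(** * Additive characters modulo m *)

Section AdditiveCharacter.
Variables (R : realType) (m : nat).

Lemma e_D (x y : R) : e_ m (x + y) = e_ m x * e_ m y.
Proof. by rewrite /e_ mulrDr mulrDl cosD sinD; simpc; congr (_ +i* _); rewrite addrC. Qed.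

Lemma e_0 : e_ m (0 : R) = 1.
Proof. by rewrite /e_ mulr0 mul0r cos0 sin0. Qed.

Lemma e_X (x : R) n : e_ m (x * n%:R) = e_ m x ^+ n.
Proof.
elim: n => [|n IHn]; first by rewrite mulr0 e_0.
by rewrite -natr1 mulrDr mulr1 e_D IHn exprSr.
Qed.

Lemma normc_e (x : R) : normc (e_ m x) = 1.
Proof. by rewrite /normc /= cos2Dsin2 sqrtr1. Qed.

Hypothesis m_gt0 : (0 < m)%N.
Let m_neq0 : m%:R != 0 :> R. Proof. by rewrite pnatr_eq0 -lt0n. Qed.

Lemma e_period (q : int) : e_ m (q%:~R * m%:R : R) = 1.
Proof.
have e1 : e_ m (m%:R : R) = 1.
  by rewrite /e_ mulfK // mulr_natl cos2pi sin2pi.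
case: q => n; first by rewrite -pmulrn mulrC e_X e1 expr1n.
have : e_ m ((Negz n)%:~R * m%:R + m%:R * n.+1%:R : R) = 1.
  by rewrite NegzE mulrNz -pmulrn [X in _ + X]mulrC mulNr addNr e_0.
by rewrite e_D (e_X m%:R n.+1) e1 expr1n mulr1.
Qed.

(** A nonzero remainder [r] would put [y = pi * r / m] strictly between 0 and [pi], where
    [sin y > 0], while [cos (2 * y) = 1] forces [sin y = 0]. *)
Lemma e_eq1 (n : int) : e_ m (n%:~R : R) = 1 -> (m%:Z %| n)%Z.
Proof.
rewrite {1}(divz_eq n m) rmorphD rmorphM /= e_D e_period mul1r => en.
have m0 : m%:Z != 0 by lia.
apply/dvdz_mod0P/eqP; apply: contraT => r0.
have r_ge0 := modz_ge0 n m0; have r_lt := ltz_mod n m0.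
set r := (n %% m)%Z in en r0 r_ge0 r_lt.
have r_gt0 : 0 < r by rewrite lt0r r0.
have r_m : r < m%:Z by move: r_lt; lia.
pose y : R := pi * r%:~R / m%:R.
have mR : (0 : R) < m%:R by rewrite ltr0n.
have rR : (0 : R) < r%:~R by rewrite ltr0z.
have rmR : (r%:~R : R) < m%:R by rewrite -[m%:R]/(m%:Z%:~R) ltr_int.
have y_bounds : 0 < y < pi.
  rewrite divr_gt0 ?mulr_gt0 ?pi_gt0 //= ltr_pdivrMr // ltr_pM2l ?pi_gt0 //.
have := sin_gt0_pi y_bounds.
have : cos (y + y) = 1.
  have -> : y + y = 2 * pi * r%:~R / m%:R by rewrite /y; ring.
  by move: en; rewrite /e_ => -[].
rewrite cosD -!expr2; have := cos2Dsin2 y => h1 h2 h3.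
have : sin y ^+ 2 = 0 by lra.
by move/eqP; rewrite sqrf_eq0 gt_eqF.
Qed.
End AdditiveCharacter.

Section ZpCharacter.
Variables (R : realType) (m : nat) (a : int).
Hypotheses (m_gt1 : (1 < m)%N) (a_m : coprimez a m).

Definition Zp_char (t : 'Z_m) : R[i] := e_ m (a%:~R * t%:R).

(** Independence of the representative, from which additivity follows. *)
Lemma Zp_char_nat (n : nat) : Zp_char n%:R = e_ m (a%:~R * n%:R).
Proof.
rewrite /Zp_char (val_Zp_nat m_gt1) [in RHS](divn_eq n m) natrD mulrDr e_D.
have -> : a%:~R * (n %/ m * m)%:R = (a * (n %/ m)%:Z)%:~R * m%:R :> R.
  by rewrite natrM rmorphM /= mulrA.
by rewrite e_period ?mul1r // ltnW.
Qed.

Lemma Zp_charE (t : 'Z_m) : t = (t : nat)%:R. Proof. by rewrite natr_Zp. Qed.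

Lemma Zp_charD s t : Zp_char (s + t) = Zp_char s * Zp_char t.
Proof. by rewrite [in LHS](Zp_charE s) [in LHS](Zp_charE t) -natrD Zp_char_nat natrD mulrDr e_D. Qed.

Lemma Zp_charM s t : Zp_char (s * t) = e_ m (a%:~R * (s : nat)%:R * (t : nat)%:R).
Proof. by rewrite [in LHS](Zp_charE s) [in LHS](Zp_charE t) -natrM Zp_char_nat natrM mulrA. Qed.

Lemma Zp_char0 : Zp_char 0 = 1.
Proof. by rewrite /Zp_char mulr0 e_0. Qed.

(** Shifting [l] by one multiplies the sum by [Zp_char d], which differs from 1 because [a] is
    coprime to [m]. *)
Lemma Zp_char_orth d : d != 0 -> \sum_l Zp_char (l * d) = 0.
Proof.
move=> d0; have char_d : Zp_char d != 1.
  apply: contra d0 => /eqP; rewrite /Zp_char -[X in _ * X]/((d : nat)%:Z%:~R) -rmorphM /=.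
  move=> /(e_eq1 _ _ (ltnW m_gt1)); rewrite Gauss_dvdzr ?[coprimez _ a]coprimez_sym //.
  rewrite dvdzE /= => /dvdn_leq m_d; have d_m : (d < m)%N.
    by rewrite -[X in (_ < X)%N](Zp_cast m_gt1) ltn_ord.
  apply/eqP/val_inj => /=; case: (posnP d) => // /m_d; lia.
set S := \sum_l _; have : S * Zp_char d = S.
  rewrite mulr_suml /S [RHS](reindex_inj (addIr 1)) /=; apply: eq_bigr => l _.
  by rewrite mulrDl mul1r Zp_charD.
move/eqP; rewrite -subr_eq0 -[X in _ - X]mulr1 -mulrBr mulf_eq0 subr_eq0.
by rewrite (negPf char_d) orbF => /eqP.
Qed.
End ZpCharacter.

Lemma sum_coprime_ord (M : nmodType) (N m : nat) (F : nat -> M) :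
  \sum_(1 <= x < N.+1 | coprime x m) F x = \sum_(x : coprime_ord N m) F (val (val x)).+1.
Proof.
rewrite big_add1 /= big_mkord.
by rewrite (big_sub [pred x : 'I_N | coprime x.+1 m] (fun x => F x.+1)).
Qed.

(** Clears the fractional exponents once the target inequality is raised to an integer power. *)
Lemma powR_root (R : realType) (x e : R) (n p : nat) :
  0 <= x -> e * n%:R = p%:R -> (x `^ e) ^+ n = x ^+ p.
Proof. by move=> x0 en; rewrite -powR_mulrn ?powR_ge0 // -powRrM en powR_mulrn. Qed.

(** * The Kloosterman sum *)

(** With [u] the inverse in ['Z_m], the sum is a [bilinear_sum] and [tuple_sum] becomes
    [sum_inv]. *)
Lemma kloosterman_sum_power (R : realType) (m N1 N2 : nat) (alpha1 alpha2 : nat -> R[i])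
    (k1 k2 : nat) (a : int) :
  (1 < m)%N ->
  (forall x : nat, (1 <= x <= N1)%N -> `|alpha1 x| <= 1) ->
  (forall x : nat, (1 <= x <= N2)%N -> `|alpha2 x| <= 1) ->
  (0 < k1)%N -> (0 < k2)%N -> coprimez a m ->
  normc (\sum_(1 <= x1 < N1.+1 | coprime x1 m)
       \sum_(1 <= x2 < N2.+1 | coprime x2 m)
         alpha1 x1 * alpha2 x2 *
         e_ m (a%:~R * (modinv m x1)%:R * (modinv m x2)%:R)) ^+ (2 * k1 * k2) <=
  N1%:R ^+ (2 * k1 * k2.-1) * N2%:R ^+ (2 * k2 * k1.-1) * m%:R
  * #|sum_inv_pairs N1 m k1|%:R
  * #|sum_inv_pairs N2 m k2|%:R.
Proof.
move=> m_gt1 al1 al2 k1_gt0 k2_gt0 a_m.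
pose u N (x : coprime_ord N m) : 'Z_m := (val (val x)).+1%:R^-1.
pose al N (alpha : nat -> R[i]) (x : coprime_ord N m) := alpha (val (val x)).+1.
have al_le1 N alpha : (forall x : nat, (1 <= x <= N)%N -> `|alpha x| <= 1) ->
    forall x, normc (al N alpha x) <= 1.
  by move=> le1 x; rewrite -lecR; apply: le1; rewrite /= ltn_ord.
have -> : \sum_(1 <= x1 < N1.+1 | coprime x1 m) \sum_(1 <= x2 < N2.+1 | coprime x2 m)
    alpha1 x1 * alpha2 x2 * e_ m (a%:~R * (modinv m x1)%:R * (modinv m x2)%:R) =
    bilinear_sum R 'Z_m (Zp_char R m a) _ _ (u N1) (u N2) (al N1 alpha1) (al N2 alpha2).
  rewrite sum_coprime_ord; apply: eq_bigr => x1 _.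
  rewrite sum_coprime_ord; apply: eq_bigr => x2 _.
  by rewrite Zp_charM.
have := bilinear_sum_bound R 'Z_m (Zp_char R m a) (Zp_charD R m a m_gt1) (Zp_char0 R m a)
  (fun s => normc_e _ _ _) (Zp_char_orth R m a m_gt1 a_m) _ _ (u N1) (u N2) _ _ _ _ k1_gt0 k2_gt0
  (al_le1 _ _ al1) (al_le1 _ _ al2).
move/le_trans; apply.
have cardZ : #|'Z_m| = m by rewrite card_ord Zp_cast.
rewrite cardZ !ler_wpM2r // ler_pM ?exprn_ge0 // lerXn2r ?nnegrE //.
  by rewrite ler_nat card_coprime_ord.
by rewrite ler_nat card_coprime_ord.
Qed.

(** The factor [m] of the power bound is shared as one [sqrt m] per variable; joined to the bound
    for the pairs, it produces the bracket of the theorem. *)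
Lemma pair_count_factor (R : realType) (m N k l : nat) :
  (0 < m)%N -> (0 < N)%N -> (0 < k)%N -> (0 < l)%N ->
  (N%:R : R) ^+ (2 * k * l.-1) * Num.sqrt m%:R
    * ((N%:R ^+ (2 * k - 1) / m%:R + 1) * N%:R ^+ k) =
  (N%:R ^+ (k - 1) / Num.sqrt m%:R + Num.sqrt m%:R / N%:R ^+ k) * N%:R ^+ (2 * k * l).
Proof.
move=> m_gt0 N_gt0 k_gt0 l_gt0.
have N0 : N%:R != 0 :> R by rewrite pnatr_eq0 -lt0n.
have s0 : Num.sqrt m%:R != 0 :> R by rewrite gt_eqF // sqrtr_gt0 ltr0n.
have mE : m%:R = Num.sqrt m%:R ^+ 2 :> R by rewrite sqr_sqrtr.
rewrite [X in _ / X]mE.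
have -> : (2 * k * l = 2 * k * l.-1 + (k + k))%N by case: l l_gt0 => // l _; lia.
have -> : (2 * k - 1 = k + (k - 1))%N by lia.
rewrite !exprD; have Nk0 : (N%:R : R) ^+ k != 0 by rewrite expf_neq0.
move: (_ ^+ k) (_ ^+ (k - 1)) (_ ^+ (2 * k * l.-1)) Nk0 (Num.sqrt _) s0 => x y z x0 s s0.
by field; rewrite x0 s0.
Qed.

Theorem theorem3 (R : realType) :
  exists m0 : nat, forall m : nat, (m0 <= m)%N ->
  forall (N1 N2 : nat), (0 < N1)%N -> (0 < N2)%N ->
  forall (alpha1 alpha2 : nat -> R[i]),
  (forall x : nat, (1 <= x <= N1)%N -> `|alpha1 x| <= 1) ->
  (forall x : nat, (1 <= x <= N2)%N -> `|alpha2 x| <= 1) ->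
  forall (k1 k2 : nat), (0 < k1)%N -> (0 < k2)%N ->
  forall a : int, coprimez a m ->
  `| \sum_(1 <= x1 < N1.+1 | coprime x1 m)
       \sum_(1 <= x2 < N2.+1 | coprime x2 m)
         alpha1 x1 * alpha2 x2 *
         e_ m (a%:~R * (modinv m x1)%:R * (modinv m x2)%:R) |
  < ((2 * k1)%:R `^ ((45 * k1 ^ 2)%:R / k2%:R)
     * (2 * k2)%:R `^ ((45 * k2 ^ 2)%:R / k1%:R)
     * ln m%:R `^ (2 * (k1%:R / k2%:R + k2%:R / k1%:R))
     * (N1%:R ^+ (k1 - 1) / Num.sqrt m%:R + Num.sqrt m%:R / N1%:R ^+ k1)
         `^ (1 / (2 * k1 * k2)%:R)
     * (N2%:R ^+ (k2 - 1) / Num.sqrt m%:R + Num.sqrt m%:R / N2%:R ^+ k2)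
         `^ (1 / (2 * k1 * k2)%:R)
     * N1%:R * N2%:R)%:C.
Proof.
exists 4%N => m m4 N1 N2 N1_gt0 N2_gt0 alpha1 alpha2 al1 al2 k1 k2 k1_gt0 k2_gt0 a a_m.
have m_gt1 : (1 < m)%N by apply: leq_trans m4.
have m_gt0 : (0 < m)%N by apply: ltnW.
rewrite normCE ltcR.
have := kloosterman_sum_power R m N1 N2 alpha1 alpha2 k1 k2 a m_gt1 al1 al2 k1_gt0 k2_gt0 a_m.
set S := normc _ => S_le.
have L0 : 0 <= ln (m%:R : R) by rewrite (le_trans ler01) ?ln_nat_ge1.
pose F N k : R := N%:R ^+ (k - 1) / Num.sqrt m%:R + Num.sqrt m%:R / N%:R ^+ k.
have F0 N k : 0 <= F N k.
  by rewrite addr_ge0 // mulr_ge0 ?invr_ge0 ?exprn_ge0 ?sqrtr_ge0.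
rewrite -/(F N1 k1) -/(F N2 k2).
have n_gt0 : (0 < 2 * k1 * k2)%N by rewrite !muln_gt0 k1_gt0.
have k10 : k1%:R != 0 :> R by rewrite pnatr_eq0 -lt0n.
have k20 : k2%:R != 0 :> R by rewrite pnatr_eq0 -lt0n.
(* Both sides are raised to the power [2 * k1 * k2]; the exponent [45 * k1 ^ 2 / k2] becomes
   [90 * k1 ^ 3], and that of the logarithm [4 * k1 ^ 2 + 4 * k2 ^ 2]. *)
rewrite -(ltr_pXn2r n_gt0) ?nnegrE ?normc_ge0 //; last first.
  by rewrite !mulr_ge0 ?powR_ge0.
apply: (le_lt_trans S_le); rewrite !exprMn.
rewrite (powR_root R (2 * k1)%:R _ _ (90 * k1 ^ 3)) //; last first.
  by rewrite !natrM ?natrX; field.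
rewrite (powR_root R (2 * k2)%:R _ _ (90 * k2 ^ 3)) //; last first.
  by rewrite !natrM ?natrX; field.
rewrite (powR_root R (ln _) _ _ (4 * k1 ^ 2 + 4 * k2 ^ 2)) //; last first.
  by rewrite natrD !natrM ?natrX; field; rewrite k10 k20.
rewrite !(powR_root R (F _ _) _ _ 1) ?mulfVK ?pnatr_eq0 -?lt0n // !expr1.
have B1 := sum_inv_pairs_bound R N1 m k1 m4 N1_gt0 k1_gt0.
have B2 := sum_inv_pairs_bound R N2 m k2 m4 N2_gt0 k2_gt0.
have P1 := pair_count_factor R m N1 k1 k2 m_gt0 N1_gt0 k1_gt0 k2_gt0.
have P2 := pair_count_factor R m N2 k2 k1 m_gt0 N2_gt0 k2_gt0 k1_gt0.
rewrite -/(F N1 k1) in P1; rewrite -/(F N2 k2) (_ : 2 * k2 * k1 = 2 * k1 * k2)%N in P2; last by lia.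
set J1 := #|_|%:R in B1 *; set J2 := #|_|%:R in B2 *.
set D1 := (_ + 1) in B1 P1; set D2 := (_ + 1) in B2 P2.
set A1 := N1%:R ^+ _ in P1 *; set A2 := N2%:R ^+ _ in P2 *.
set L := ln _ in B1 B2 L0 *.
set s := Num.sqrt _ in P1 P2; have sE : m%:R = s * s by rewrite -expr2 sqr_sqrtr.
have A1_gt0 : 0 < A1 * A2 * m%:R by rewrite !mulr_gt0 ?exprn_gt0 ?ltr0n.
have J_lt : J1 * J2 < _ := ltr_pM (ler0n _ _) (ler0n _ _) B1 B2.
move: J_lt; rewrite -(ltr_pM2l A1_gt0) [X in X < _]mulrA => /lt_le_trans; apply.
(* Strictness came from the two pair counts; what remains is an identity. *)
rewrite le_eqVlt; apply/orP; left; apply/eqP.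
rewrite !natrX; set C1 := (2 * k1)%:R ^+ _; set C2 := (2 * k2)%:R ^+ _; rewrite exprD.
transitivity (C1 * C2 * (L ^+ (4 * k1 ^ 2) * L ^+ (4 * k2 ^ 2)) *
  (A1 * s * (D1 * N1%:R ^+ k1)) * (A2 * s * (D2 * N2%:R ^+ k2))).
  by rewrite sE; ring.
by rewrite P1 P2; ring.
Qed.
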